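(* Let $F$ be a graph with chromatic number $\chi(F)\geq 4$, and let $F^{o}$ be an odd-ballooning of $F$ in which every substituted odd cycle has length at least five. Then for all sufficiently large $n$ (depending on $F^{o}$), ${\rm EX}(n,F^{o})={\rm EX}(n,F)$.
   Context: For a family $\mathcal{F}$ of graphs, a graph is $\mathcal{F}$-free if it contains no subgraph isomorphic to a member of $\mathcal{F}$; ${\rm ex}(n,\mathcal{F})$ is the maximum number of edges of an $n$-vertex $\mathcal{F}$-free graph, and ${\rm EX}(n,\mathcal{F})$ is the set of $n$-vertex $\mathcal{F}$-free graphs with exactly ${\rm ex}(n,\mathcal{F})$ edges (for a single graph $F$ write ${\rm ex}(n,F)$, ${\rm EX}(n,F)$). The odd-ballooning $F^{o}$ of a graph $F$ is obtained from $F$ by replacing each edge $uv$ with an odd cycle $C(u,v)$ through the edge $uv$ (i.e., adding a new path between $u$ and $v$ of even length $\ell_{u,v}-1$ with new internal vertices), where all new vertices of the different cycles are distinct; different edges may receive odd cycles of different lengths $\ell_{u,v}$. Here every $\ell_{u,v}\geq 5$. *)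

(* Defs.v *)
From mathcomp Require Import all_boot.

Set Implicit Arguments.
Unset Strict Implicit.
Unset Printing Implicit Defensive.

Definition simple_edges (T : finType) (E : {set {set T}}) : bool :=
  [forall e in E, #|e| == 2].

(* Simple graphs with vertex set T, given by their set of (unordered) edges.  *)
(* This is a finType, so that the n-vertex graphs, taken on 'I_n, can be      *)
(* collected in a {set _}.                                                    *)
Definition sgraph (T : finType) : Type :=
  {E : {set {set T}} | simple_edges E}.

Definition edges (T : finType) (G : sgraph T) : {set {set T}} := sval G.

Definition adj (T : finType) (G : sgraph T) : rel T :=
  fun u v => [set u; v] \in edges G.

Definition proper_coloring (T : finType) (G : sgraph T) (k : nat)
    (c : {ffun T -> 'I_k}) : bool :=
  [forall u, forall v, adj G u v ==> (c u != c v)].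

Definition colorable (T : finType) (G : sgraph T) (k : nat) : bool :=
  [exists c : {ffun T -> 'I_k}, proper_coloring G c].

Lemma adj_neq (T : finType) (G : sgraph T) (u v : T) : adj G u v -> u != v.
Proof.
move=> uv; have /forall_inP/(_ _ uv) := valP G.
by rewrite cards2; case: (u != v).
Qed.

Lemma colorable_ex (T : finType) (G : sgraph T) : exists k, colorable G k.
Proof.
exists #|T|; apply/existsP; exists [ffun x => enum_rank x].
apply/forallP => u; apply/forallP => v; apply/implyP => uv.
by rewrite !ffunE (inj_eq enum_rank_inj); apply: adj_neq uv.
Qed.

Definition chromatic_number (T : finType) (G : sgraph T) : nat :=
  ex_minn (colorable_ex G).

(* An injective, edge-preserving map identifies F with a (not necessarily     *)
(* induced) subgraph of G.                                                    *)
Definition contains (S T : finType) (F : sgraph S) (G : sgraph T) : bool :=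
  [exists f : {ffun S -> T},
    injectiveb f && [forall u, forall v, adj F u v ==> adj G (f u) (f v)]].

Definition is_free (S T : finType) (F : sgraph S) (G : sgraph T) : bool :=
  ~~ contains F G.

Definition ex_num (n : nat) (S : finType) (F : sgraph S) : nat :=
  \max_(G : sgraph 'I_n | is_free F G) #|edges G|.

Definition EX (n : nat) (S : finType) (F : sgraph S) : {set sgraph 'I_n} :=
  [set G : sgraph 'I_n | is_free F G & #|edges G| == ex_num n F].

Definition rel_edges (T : finType) (r : rel T) : {set {set T}} :=
  [set e : {set T} |
    [exists u, exists v, [&& e == [set u; v], u != v & r u v]]].

Lemma rel_edges_simple (T : finType) (r : rel T) : simple_edges (rel_edges r).
Proof.
apply/forall_inP => e; rewrite inE => /existsP[u /existsP[v /and3P[/eqP-> uv _]]].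
by rewrite cards2 uv.
Qed.

(* The graph in which distinct u, v are adjacent iff r u v or r v u.          *)
Definition rel_graph (T : finType) (r : rel T) : sgraph T :=
  exist _ (rel_edges r) (rel_edges_simple r).

(* Each edge {u, v} occurs once as an arc (u, v), with an orientation that    *)
(* serves only to number the new vertices from u to v.                        *)
Definition oriented_edge (T : finType) (F : sgraph T) : Type :=
  {p : T * T | adj F p.1 p.2 && (enum_rank p.1 < enum_rank p.2)}.

Definition src (T : finType) (F : sgraph T) (a : oriented_edge F) : T := (sval a).1.
Definition tgt (T : finType) (F : sgraph T) (a : oriented_edge F) : T := (sval a).2.

(* The cycle substituted for an edge e has length l e, hence l e - 2 new      *)
(* vertices.                                                                  *)
Definition inner (T : finType) (F : sgraph T) (l : {set T} -> nat)
    (a : oriented_edge F) : nat := l [set src a; tgt a] - 2.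

Definition balloon_vertex (T : finType) (F : sgraph T) (l : {set T} -> nat) :
    finType :=
  (T + {a : oriented_edge F & 'I_(inner l a)})%type.

(* The edges of F, and for each arc a the edges of the new path               *)
(*   src a, (a, 0), (a, 1), ..., (a, inner l a - 1), tgt a                    *)
(* of length l e - 1, where e is the edge underlying a.                       *)
Definition balloon_rel (T : finType) (F : sgraph T) (l : {set T} -> nat) :
    rel (balloon_vertex F l) :=
  fun x y =>
    match x, y with
    | inl u, inl v => adj F u v
    | inl u, inr w => (u == src (tag w)) && (tagged w == 0 :> nat)
    | inr w, inl v =>
        (v == tgt (tag w)) && ((tagged w).+1 == inner l (tag w) :> nat)
    | inr w, inr z =>
        (tag w == tag z) && ((tagged w).+1 == tagged z :> nat)
    end.

(* F with each edge e replaced by a cycle of length l e through e; it is an   *)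
(* odd-ballooning of F when l is odd (and at least 3) on the edges of F.      *)
Definition ballooning (T : finType) (F : sgraph T) (l : {set T} -> nat) :
    sgraph (balloon_vertex F l) :=
  rel_graph (@balloon_rel T F l).

(* Main.v *)
(* Write r + 1 for the chromatic number of F, so r >= 3.  As F is a subgraph of its
   ballooning F^o, it suffices that a large extremal F^o-free graph G is F-free.  If
   G has minimum degree well above n / 2, any two vertices have linearly many common
   neighbours, so the new paths can be attached greedily to a copy of F, and a copy of
   F would give a copy of F^o.  The minimum degree bound comes from Simonovits' cloning
   argument: if some #|F^o| + 1 vertices have a common neighbourhood C, then replacing
   any vertex v by a new vertex joined to C keeps G F^o-free, hence deg v >= |C| - 1.
   Such vertices with |C| >= 11 n / 20 are found in one part of a large complete
   r-partite subgraph, which exists by Erdos-Stone in an almost spanning subgraph of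
   minimum degree about (1 - 1 / r) n.  Densities are written with cleared
   denominators, and deg_sum counts every edge twice. *)

Require Import Defs.
From mathcomp Require Import all_boot.
From mathcomp Require Import zify.

Set Implicit Arguments.
Unset Strict Implicit.
Unset Printing Implicit Defensive.

(** * Degree sums, complete multipartite subgraphs and dense cores *)

Definition nbhd (V : finType) (e : rel V) (U : {set V}) (x : V) : {set V} :=
  [set y in U | e x y].

Definition deg_sum (V : finType) (e : rel V) (U : {set V}) : nat :=
  \sum_(x in U) #|nbhd e U x|.

(** Only the values of [A] below [r] matter. Edges inside a part are unrestricted, and for
    irreflexive [e] the adjacency clause makes the parts disjoint. *)
Definition multipartite (V : finType) (e : rel V) (U : {set V}) (r m : nat)
    (A : nat -> {set V}) : Prop :=
  (forall i, i < r -> A i \subset U /\ #|A i| = m) /\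
  (forall i j x y, i < r -> j < r -> i != j -> x \in A i -> y \in A j -> e x y).

Lemma subset_of_card (V : finType) (A : {set V}) (m : nat) :
  m <= #|A| -> exists2 B : {set V}, B \subset A & #|B| = m.
Proof.
move=> mA; exists [set x in take m (enum A)].
  by apply/subsetP => x; rewrite inE => /mem_take; rewrite mem_enum.
rewrite cardsE; have /card_uniqP -> := take_uniq m (enum_uniq A).
by rewrite size_takel // -cardE.
Qed.

Lemma multipartite_sub (V : finType) (e : rel V) (U W : {set V}) (r m : nat)
    (A : nat -> {set V}) :
  U \subset W -> multipartite e U r m A -> multipartite e W r m A.
Proof.
move=> UW [KA1 KA2]; split=> // i ir; have [AU ->] := KA1 i ir.
by split=> //; apply: subset_trans UW.
Qed.

Lemma card_incidence (V : finType) (e : rel V) (A B : {set V}) :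
  symmetric e -> \sum_(x in A) #|nbhd e B x| = \sum_(y in B) #|nbhd e A y|.
Proof.
move=> e_sym.
have cnt (C : {set V}) x : #|nbhd e C x| = \sum_(y in C) e x y.
  rewrite -sum1_card big_mkcond /= [RHS]big_mkcond /=.
  by apply: eq_bigr => y _; rewrite inE; case: (y \in C); case: (e x y).
under eq_bigr => x _ do rewrite cnt.
rewrite exchange_big /=; apply: eq_bigr => y _; rewrite cnt.
by apply: eq_bigr => x _; rewrite e_sym.
Qed.

Lemma nbhd_card_le (V : finType) (e : rel V) (A : {set V}) (x : V) :
  #|nbhd e A x| <= #|A|.
Proof. by apply/subset_leq_card/subsetP => y; rewrite inE => /andP[]. Qed.

Lemma deg_sum_le (V : finType) (e : rel V) (U : {set V}) :
  deg_sum e U <= #|U| * #|U|.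
Proof. by rewrite -sum_nat_const; apply: leq_sum => x _; apply: nbhd_card_le. Qed.

Lemma deg_sumD1 (V : finType) (e : rel V) (U : {set V}) (v : V) :
  symmetric e -> irreflexive e -> v \in U ->
  deg_sum e U = deg_sum e (U :\ v) + 2 * #|nbhd e U v|.
Proof.
move=> e_sym e_irr vU; rewrite /deg_sum (big_setD1 v vU) /=.
have sz x : #|nbhd e U x| = #|nbhd e (U :\ v) x| + e x v.
  rewrite (cardsD1 v) !inE vU /= addnC; congr (_ + _).
  by apply: eq_card => y; rewrite !inE; case: (y == v); rewrite ?andbF.
under eq_bigr => x _ do rewrite sz.
rewrite big_split /=.
have -> : \sum_(x in U :\ v) (e x v : nat) = #|nbhd e U v|.
  rewrite sz e_irr addn0 -sum1_card big_mkcond /= [RHS]big_mkcond /=.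
  by apply: eq_bigr => x _; rewrite !inE e_sym; case: (_ && _); case: (e v x).
lia.
Qed.

(* The subset of least cardinality that stays this dense cannot afford a vertex
   of degree below a / b times its size. *)
Lemma dense_core (V : finType) (e : rel V) (U : {set V}) (a b K : nat) :
  symmetric e -> irreflexive e ->
  a * (#|U| * #|U|) + K <= b * deg_sum e U ->
  exists W : {set V}, [/\ W \subset U,
    a * (#|W| * #|W|) + K <= b * deg_sum e W &
    forall v, v \in W -> 2 * a * #|W| <= 2 * b * #|nbhd e W v| + a].
Proof.
move=> e_sym e_irr dU.
pose P := [pred W : {set V} | a * (#|W| * #|W|) + K <= b * deg_sum e W].
have [W /minsetP[PW minW] WU] := @minset_exists _ P U dU.
exists W; split=> // v vW.
rewrite leqNgt; apply/negP => small.
have: P (W :\ v).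
  rewrite /=; move: PW small; rewrite /= (deg_sumD1 e_sym e_irr vW) (cardsD1 v W) vW.
  nia.
move=> /minW -/(_ (subsetDl _ _)) eqW.
by move: vW; rewrite -{1}eqW !inE eqxx.
Qed.

(** * The Erdos-Stone theorem, for minimum degree and for edge counts *)

Lemma pigeonhole_fiber (V I : finType) (W : {set V}) (Q : {set I}) (f : V -> I)
    (m : nat) :
  0 < m -> (forall x, x \in W -> f x \in Q) -> m * #|Q| <= #|W| -> 0 < #|W| ->
  exists i, m <= #|[set x in W | f x == i]|.
Proof.
move=> m0 fQ big W0.
case: (boolP [exists i, m <= #|[set x in W | f x == i]|]) => [/existsP //|].
rewrite negb_exists => /forallP small.
have: #|W| = \sum_(i in Q) #|[set x in W | f x == i]|.
  rewrite -sum1_card (partition_big f (mem Q)) //=.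
  apply: eq_bigr => i _; rewrite -sum1_card.
  by apply: eq_bigl => x; rewrite inE.
have: \sum_(i in Q) #|[set x in W | f x == i]| <= \sum_(i in Q) m.-1.
  by apply: leq_sum => i _; move: (small i); lia.
have [x xW] : exists x, x \in W by apply/set0Pn; rewrite -card_gt0.
have : 0 < #|Q| by rewrite card_gt0; apply/set0Pn; exists (f x); apply: fQ.
rewrite sum_nat_const; nia.
Qed.

(** The union [X] of the parts has at most 2 ^ (r M) subsets, so some [m] vertices of [W] have the
    same trace on [X]. They form the new part, and each old part shrinks to [m] vertices of this
    common trace. *)
Lemma multipartite_extend (V : finType) (e : rel V) (U W : {set V})
    (r m M : nat) (A : nat -> {set V}) :
  symmetric e -> 0 < m -> multipartite e U r M A -> W \subset U ->
  (forall x i, x \in W -> i < r -> m <= #|nbhd e (A i) x|) ->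
  m * 2 ^ (r * M) <= #|W| ->
  exists B, multipartite e U r.+1 m B.
Proof.
move=> e_sym m0 [Asz Aadj] WU Wgood Wbig.
pose X := \bigcup_(i < r) A i.
have Xle : #|X| <= r * M.
  rewrite /X; apply: leq_trans (_ : \sum_(i < r) #|A i| <= _).
    elim/big_ind2: _ => [|B b C c hB hC|//]; first by rewrite cards0.
    by apply: leq_trans (leq_card_setU _ _) _; apply: leq_add.
  rewrite (eq_bigr (fun=> M)); last by move=> i _; have [] := Asz i (ltn_ord i).
  by rewrite sum_nat_const card_ord.
have [|||i mi] := @pigeonhole_fiber _ _ W (powerset X) (nbhd e X) m m0.
- by move=> x _; rewrite inE; apply/subsetP => y; rewrite inE => /andP[].
- rewrite card_powerset; apply: leq_trans Wbig.
  by rewrite leq_mul2l leq_exp2l // Xle orbT.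
- by apply: leq_trans Wbig; rewrite muln_gt0 m0 expn_gt0.
have [S SW Sm] := subset_of_card mi.
have [x xS] : exists x, x \in S by apply/set0Pn; rewrite -card_gt0 Sm.
have inS y : y \in S -> y \in W /\ nbhd e X y = i.
  by move/(subsetP SW); rewrite inE => /andP[-> /eqP].
have [B HB] : exists B : nat -> {set V}, forall j, j < r ->
    B j \subset nbhd e (A j) x /\ #|B j| = m.
  (* The guard makes [p j] satisfiable for every [j], so that [xchoose] yields a total family. *)
  pose p j (B : {set V}) := (j < r) ==> (B \subset nbhd e (A j) x) && (#|B| == m).
  have ex j : exists B, p j B.
    rewrite /p; case: ltnP => [jr|]; last by exists set0.
    have [B BN Bm] := subset_of_card (Wgood x j (inS _ xS).1 jr).
    by exists B; rewrite BN Bm eqxx.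
  exists (fun j => xchoose (ex j)) => j jr.
  by move: (xchooseP (ex j)) => /implyP/(_ jr)/andP[-> /eqP].
have BA j y : j < r -> y \in B j -> y \in A j.
  by move=> jr; have [/subsetP h _] := HB j jr; move/h; rewrite inE => /andP[].
have BS j y z : j < r -> y \in B j -> z \in S -> e z y.
  move=> jr yB /inS[_ zi]; have : y \in nbhd e X x.
    have [/subsetP/(_ _ yB)] := HB j jr; rewrite !inE => /andP[yA ->] _.
    by rewrite andbT; apply/bigcupP; exists (Ordinal jr).
  by rewrite (inS _ xS).2 -zi inE => /andP[].
exists (fun j => if j < r then B j else S); split=> [j|j k y z].
  move=> _; case: ltnP => jr; last first.
    by split=> //; apply/subsetP => y yS; exact: (subsetP WU _ (inS _ yS).1).
  have [_ ->] := HB j jr; split=> //; apply/subsetP => y /(BA _ _ jr).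
  by have [/subsetP h _] := Asz j jr; apply: h.
rewrite !ltnS => jr kr jk; case: ltnP => jr'; case: ltnP => kr' yB zB.
- by apply: (Aadj j k) => //; apply: BA.
- by rewrite e_sym; apply: (BS j).
- exact: (BS k).
- by case/eqP: jk; apply/eqP; rewrite eqn_leq (leq_trans jr) ?(leq_trans kr).
Qed.

(** A vertex poor in one part loses [M - m] of its possible neighbours. Moving [M] to the left
    avoids truncated subtraction. *)
Lemma sum_deficient (r m M j : nat) (a : nat -> nat) :
  j < r -> (forall i, i < r -> a i <= M) -> a j <= m ->
  \sum_(i < r) a i + M <= r * M + m.
Proof.
move=> jr aM ajm; rewrite (bigD1 (Ordinal jr)) //=.
have: \sum_(i < r | i != Ordinal jr) a i <= \sum_(i < r | i != Ordinal jr) M.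
  by apply: leq_sum => i _; apply: aM.
have: \sum_(i < r) M = r * M by rewrite sum_nat_const card_ord.
rewrite (bigD1 (Ordinal jr)) //=.
by set x := \sum_(i < r | _) _; set y := \sum_(i < r | _) _; lia.
Qed.

Lemma multipartite_deg_sum (V : finType) (e : rel V) (U : {set V})
    (r M c d : nat) (A : nat -> {set V}) :
  symmetric e -> multipartite e U r M A ->
  (forall y, y \in U -> d <= c * #|nbhd e U y|) ->
  forall i, i < r -> M * d <= c * \sum_(x in U) #|nbhd e (A i) x|.
Proof.
move=> e_sym [Asz _] Udeg i ir; have [AU Am] := Asz i ir.
rewrite card_incidence // -Am -sum_nat_const big_distrr /=.
by apply: leq_sum => y /(subsetP AU); apply: Udeg.
Qed.

Lemma multipartite_deg_sum_all (V : finType) (e : rel V) (U : {set V})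
    (r M c d : nat) (A : nat -> {set V}) :
  symmetric e -> multipartite e U r M A ->
  (forall y, y \in U -> d <= c * #|nbhd e U y|) ->
  r * (M * d) <= c * \sum_(x in U) \sum_(i < r) #|nbhd e (A i) x|.
Proof.
move=> e_sym KA Udeg; rewrite exchange_big /= big_distrr /=.
rewrite -[X in X * _]card_ord -sum_nat_const; apply: leq_sum => i _.
exact: (multipartite_deg_sum e_sym KA Udeg).
Qed.

Definition rich (V : finType) (e : rel V) (U : {set V}) (r m : nat)
    (A : nat -> {set V}) : {set V} :=
  [set x in U | [forall i : 'I_r, m <= #|nbhd e (A i) x|]].

Lemma rich_card (V : finType) (e : rel V) (U : {set V}) (r m M : nat)
    (A : nat -> {set V}) :
  symmetric e -> 0 < m -> multipartite e U r M A ->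
  (forall B, ~ multipartite e U r.+1 m B) -> #|rich e U r m A| < m * 2 ^ (r * M).
Proof.
move=> e_sym m0 KA noK; rewrite ltnNge; apply/negP => big.
have [||B] := multipartite_extend e_sym m0 KA _ _ big; last exact: noK.
  by apply/subsetP => x; rewrite inE => /andP[].
by move=> x i; rewrite inE => /andP[_ /forallP h] ir; apply: (h (Ordinal ir)).
Qed.

(* Erdos-Stone for minimum degree (1 - 1 / r + 1 / (r q)) |U|. *)
Lemma erdos_stone_min_degree (r : nat) : forall q m : nat, 0 < q -> 0 < m ->
  exists n0, forall (V : finType) (e : rel V) (U : {set V}), symmetric e ->
    n0 <= #|U| ->
    (forall v, v \in U ->
      (r * q + 1) * #|U| <= r * q * #|nbhd e U v| + q * #|U|) ->
    exists A, multipartite e U r.+1 m A.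
Proof.
elim: r => [|r IHr] q m q0 m0.
  exists m => V e U _ /subset_of_card[B BU Bm] _; exists (fun=> B).
  by split=> // i j x y; rewrite !ltnS !leqn0 => /eqP-> /eqP->.
(* The count of edges below ends in u M <= q u m + q w M, with w the number of rich vertices. This
   [M] makes q u m half of the left side, whence u <= 2 q w. *)
pose M := 2 * q * m.
have M0 : 0 < M by rewrite /M; lia.
(* With [q := r.+1] the required density 1 - 1 / r + 1 / (r (r + 1)) is exactly 1 - 1 / (r + 1),
   below the density assumed here. *)
have [n0 IH] := IHr r.+1 M isT M0.
exists (n0 + 2 * q * r.+1 * (m * 2 ^ (r.+1 * M))) => V e U e_sym Ubig Udeg.
have [|v vU|A KA] := IH V e U e_sym; first by lia.
  have := Udeg v vU; set d := #|nbhd _ _ _|; set u := #|U| => h.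
  have : r * u <= r.+1 * d by nia.
  nia.
(* Count the edges between [U] and the parts: the degrees of the part vertices bound them below,
   while a vertex that is not rich sends at most r M + m. The excess 1 / q must come from rich
   vertices. *)
have W_ok : m * 2 ^ (r.+1 * M) <= #|rich e U r.+1 m A|.
  set u := #|U|; set w := #|_|.
  have Udeg' v : v \in U -> (r * q + 1) * u <= r.+1 * q * #|nbhd e U v|.
    by move=> /Udeg; rewrite -/u; nia.
  have lower := multipartite_deg_sum_all e_sym KA Udeg'.
  have : \sum_(x in U) (\sum_(i < r.+1) #|nbhd e (A i) x| + M) <=
         \sum_(x in U) (r.+1 * M + m + (x \in rich e U r.+1 m A) * M).
    apply: leq_sum => x xU; have AM i : i < r.+1 -> #|nbhd e (A i) x| <= M.
      move=> ir; apply: leq_trans (nbhd_card_le _ _ _) _.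
      by have [/(_ i ir)[_ ->]] := KA.
    case: (boolP (x \in _)) => [_|].
      rewrite mul1n leq_add2r (leq_trans _ (leq_addr _ _)) //.
      rewrite -[X in _ <= X * _]card_ord -sum_nat_const.
      by apply: leq_sum => i _; apply: AM.
    rewrite inE xU negb_forall => /existsP[i]; rewrite -ltnNge => /ltnW im.
    rewrite mul0n addn0.
    exact: (@sum_deficient _ _ _ _ (fun k => #|nbhd e (A k) x|) (ltn_ord i)).
  rewrite 2!big_split /= !sum_nat_const -/u -big_distrl /=.
  have -> : \sum_(x in U) (x \in rich e U r.+1 m A : nat) = w.
    rewrite /w -sum1_card big_mkcond [RHS]big_mkcond /=; apply: eq_bigr => x _.
    by rewrite inE; case: (x \in U); case: [forall _, _].
  move: lower; set s := \sum_(x in U) _ => lower upper.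
  have {}lower : M * ((r * q + 1) * u) <= q * s by move: lower; nia.
  have ub : u * M + q * (u * M) * r <= q * (u * (r * M + m) + w * M) by nia.
  have {}ub : u * M <= q * (u * m) + q * (w * M) by nia.
  have {}ub : u * q * m <= q * (w * (2 * q * m)) by move: ub; rewrite /M; nia.
  have {}ub : u <= 2 * q * w by nia.
  move: Ubig; rewrite -/u; set L := m * _ => Ubig.
  have : 2 * q * L <= 2 * q * w by nia.
  by rewrite leq_pmul2l //; lia.
apply: (multipartite_extend e_sym m0 KA _ _ W_ok).
  by apply/subsetP => x; rewrite inE => /andP[].
by move=> x i; rewrite inE => /andP[_ /forallP h] ir; apply: (h (Ordinal ir)).
Qed.

(* If U were denser, a dense core of U would keep half of the excess as minimum
   degree. *)
Lemma erdos_stone_edges (r q m : nat) : 0 < r -> 0 < q -> 0 < m ->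
  exists n0, forall (V : finType) (e : rel V) (U : {set V}),
    symmetric e -> irreflexive e -> n0 <= #|U| ->
    (forall A, ~ multipartite e U r.+1 m A) ->
    r * q * deg_sum e U + q * (#|U| * #|U|) <= (r * q + 1) * (#|U| * #|U|).
Proof.
move=> r0 q0 m0.
(* The excess is halved once by the core and once more to absorb the additive [a] in the degree
   bound of [dense_core], which is harmless as a <= |W|. *)
have [n0 ES] := @erdos_stone_min_degree r (4 * q) m ltac:(lia) m0.
case: r r0 ES => // r _ ES.
exists (2 * (r.+1 * q) * (n0 + (2 * (r * q) + 1))) => V e U e_sym e_irr Ubig noK.
rewrite leqNgt; apply/negP => dense.
set a := 2 * (r * q) + 1 in Ubig.
(* The other half of the excess is spent on K = u^2. It keeps the core large, since K is at most b
   w^2. *)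
have [|W [WU Wdense Wdeg]] :=
    @dense_core V e U a (2 * (r.+1 * q)) (#|U| * #|U|) e_sym e_irr.
  by rewrite /a; nia.
have Wbig : n0 + a <= #|W|.
  have := deg_sum_le e W; move: Wdense Ubig; set w := #|W|; set u := #|U|.
  set D := deg_sum _ _; set b := 2 * (r.+1 * q) => h1 h2 h3.
  have h4 : u * u <= b * (w * w) by nia.
  rewrite leqNgt; apply/negP => h5.
  have h6 : b * w < u by nia.
  have h7 : 0 < b by rewrite /b; nia.
  nia.
have [||A KA] := ES V e W e_sym; first by lia.
  move=> v vW; have := Wdeg v vW; move: Wbig; set w := #|W|; set d := #|nbhd _ _ _|.
  by rewrite /a; nia.
exact: noK (multipartite_sub WU KA).
Qed.

(** * Many vertices with a common neighbourhood of more than half of the graph *)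

(** Markov's inequality: at most half of [A] exceeds twice the average of [f]. *)
Lemma markov_subset (V : finType) (A : {set V}) (f : V -> nat) (m : nat) :
  2 * m <= #|A| ->
  exists S : {set V}, [/\ S \subset A, #|S| = m &
    forall y, y \in S -> #|A| * f y <= 2 * \sum_(z in A) f z].
Proof.
move=> mA; set s := \sum_(z in A) f z.
pose B := [set y in A | 2 * s < #|A| * f y].
have BA : B \subset A by apply/subsetP => y; rewrite inE => /andP[].
have hB : #|B| * (2 * s + 1) <= #|A| * s.
  rewrite -sum_nat_const; apply: leq_trans (_ : \sum_(y in B) #|A| * f y <= _).
    by apply: leq_sum => y; rewrite inE => /andP[_]; rewrite addn1.
  rewrite -big_distrr /= leq_mul2l /s; apply/orP; right.
  rewrite [X in _ <= X]big_mkcond [X in X <= _]big_mkcond /=.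
  by apply: leq_sum => y _; rewrite inE; case: (y \in A); case: (_ < _).
have hB2 : 2 * #|B| <= #|A| by nia.
have : m <= #|A :\: B| by rewrite cardsD (setIidPr BA); lia.
case/subset_of_card => S SAB Sm; exists S; split=> //.
  by apply: subset_trans SAB _; apply: subsetDl.
by move=> y /(subsetP SAB); rewrite !inE => /andP[+ yA]; rewrite yA /= -leqNgt.
Qed.

(** Asking only for density a / b, with a = t q - 1 and b = (t + 1) q, leaves a reserve K = n^2 - b
    n for [dense_core]. By Erdos-Stone the core [U] has density barely above t / (t + 1), so K is at
    most 101 / 100 u^2, which forces u >= 99 / 100 n. *)
Lemma almost_spanning_core (t m q : nat) : 0 < m -> 0 < q -> 0 < t ->
  exists n0, forall (V : finType) (e : rel V),
    symmetric e -> irreflexive e -> n0 <= #|V| ->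
    (forall B, ~ multipartite e setT t.+2 m B) ->
    t * (#|V| * #|V|) <= t.+1 * deg_sum e setT + t.+1 * #|V| ->
    exists U : {set V}, 99 * #|V| <= 100 * #|U| /\
      forall v, v \in U -> 2 * (t * q - 1) * #|U| <=
        2 * (t.+1 * q) * #|nbhd e U v| + (t * q - 1).
Proof.
move=> m0 q0 t0.
have [n1 ES] := @erdos_stone_edges t.+1 (100 * q) m isT ltac:(lia) m0.
pose b := t.+1 * q.
have b0 : 0 < b by rewrite /b; nia.
exists (1000 * b * (n1 + 1)) => V e e_sym e_irr; set n := #|V| => nbig noK dense.
have tq0 : 0 < t * q by rewrite muln_gt0 t0.
have nb : 1000 * b <= n.
  by apply: leq_trans nbig; rewrite leq_pmulr // addn1.
have n0 : 0 < n by lia.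
have [K KE] : exists K, K + b * n = n * n.
  by exists (n * n - b * n); rewrite subnK // leq_mul2r; apply/orP; right; lia.
have K1 : 999 * (n * n) <= 1000 * K.
  have: 1000 * b * n <= n * n by rewrite leq_mul2r nb orbT.
  rewrite -mulnA -KE; lia.
have [a aE] : exists a, a + 1 = t * q by exists (t * q - 1); lia.
have -> : t * q - 1 = a by lia.
have bE : b = a + 1 + q by rewrite aE /b mulSn addnC.
have [|U [_ Udense Udeg]] := @dense_core V e setT a b K e_sym e_irr.
  rewrite cardsT -/n; move: dense; set D := deg_sum _ _ => dense.
  have: q * (t * (n * n)) <= q * (t.+1 * D + t.+1 * n) by rewrite leq_mul2l dense orbT.
  have -> : q * (t * (n * n)) = a * (n * n) + n * n.
    by rewrite mulnA (mulnC q) -aE mulnDl mul1n.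
  have -> : q * (t.+1 * D + t.+1 * n) = b * D + b * n.
    by rewrite mulnDr !mulnA (mulnC q).
  lia.
exists U; split=> //.
have := deg_sum_le e U; move: Udense; set u := #|U|; set D := deg_sum _ _ => h1 h2.
have h3 : K <= b * (u * u).
  by apply: leq_trans (_ : b * D <= _); [lia|rewrite leq_mul2l h2 orbT].
(* A crude bound from K <= b u^2, needed before Erdos-Stone can be applied to [U]. *)
have ubig : n1 <= u.
  rewrite leqNgt; apply/negP => h4.
  have h5 : 1000 * (b * u) <= n.
    by apply: leq_trans nbig; rewrite mulnA leq_mul2l; apply/orP; right; lia.
  have h6 : 1000 * (b * u) * (1000 * (b * u)) <= n * n by apply: leq_mul.
  have h7 : b * (u * u) <= b * u * (b * u).
    by rewrite mulnACA leq_mul2r leq_pmulr // orbT.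
  have h8 : 0 < n * n by rewrite muln_gt0 n0.
  move: h6; rewrite mulnACA; move: h3 h7 h8 K1.
  set x := b * (u * u); set y := _ * (b * u); set z := n * n; lia.
have := ES V e U e_sym e_irr ubig (fun A KA => noK A (multipartite_sub (subsetT U) KA)).
rewrite -/u -/D => h4.
have h5 : 100 * K <= 101 * (u * u).
  have E1 : t.+1 * (100 * q) = 100 * b by rewrite /b; lia.
  have E2 : b * (u * u) = a * (u * u) + u * u + q * (u * u) by rewrite bE; lia.
  move: h4; rewrite E1; move: h1 E2; clear; lia.
rewrite leqNgt; apply/negP => h6.
have : (100 * u) * (100 * u) <= (99 * n) * (99 * n) by apply: leq_mul; apply: ltnW.
have : 0 < n * n by rewrite muln_gt0 n0.
rewrite (mulnACA 100) (mulnACA 99); move: h5 K1.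
set x := n * n; set y := u * u; lia.
Qed.

(* Let (A_i) be a complete (t + 1)-partite subgraph of U with large parts.  Only
   boundedly many vertices see m vertices of every part, so the degrees inside U
   force almost every vertex which sees m vertices of A_0 to see almost all of
   A_0. *)
Lemma clone_set_core (V : finType) (e : rel V) (U : {set V}) (t m q M L : nat)
    (A : nat -> {set V}) :
  symmetric e -> 1 < t -> 0 < m -> 0 < q ->
  multipartite e U t.+1 M A -> #|rich e U t.+1 m A| <= L -> 2 * m <= M ->
  (forall v, v \in U -> 2 * (t * q - 1) * #|U| <=
        2 * (t.+1 * q) * #|nbhd e U v| + (t * q - 1)) ->
  exists S C : {set V}, [/\ #|S| = m, (forall x y, x \in S -> y \in C -> e x y) &
    exists R Z : nat, [/\ R <= #|C| + Z,
      M * (2 * (t * q - 1) * #|U|) <=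
        2 * (t.+1 * q) * (R * M + #|U| * m) + M * (t * q - 1) &
      M * (q * Z) <=
        m * (2 * q * (#|U| * m) + 2 * q * (M * L) + 2 * M * #|U| + M * (t * q))]].
Proof.
move=> e_sym t1 m0 q0 KA richL mM Udeg.
set u := #|U| in Udeg *.
have [a aE] : exists a, a + 1 = t * q by exists (t * q - 1); nia.
have aE' : t * q - 1 = a by lia.
rewrite aE' in Udeg *.
pose R := [set x in U | m <= #|nbhd e (A 0) x|].
have A0 : #|A 0| = M by have [/(_ 0 isT)[]] := KA.
have AM i x : i < t.+1 -> #|nbhd e (A i) x| <= M.
  by move=> ir; rewrite (leq_trans (nbhd_card_le _ _ _)) //;
    have [/(_ i ir)[_ ->]] := KA.
have Udeg' v : v \in U -> 2 * a * u - a <= 2 * (t.+1 * q) * #|nbhd e U v|.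
  by move=> /Udeg; lia.
have sumR (k : nat) : \sum_(x in U) (x \in R) * k = #|R| * k.
  rewrite -big_distrl /= -sum1_card; congr (_ * _).
  rewrite big_mkcond [RHS]big_mkcond /=; apply: eq_bigr => x _.
  by rewrite inE; case: (x \in U); case: (_ <= _).
have lower0 := multipartite_deg_sum e_sym KA Udeg' (ltn0Sn t).
have upper0 : \sum_(x in U) #|nbhd e (A 0) x| <= #|R| * M + u * m.
  rewrite -sumR /u -sum_nat_const -big_split; apply: leq_sum => x xU /=.
  rewrite inE xU /=; case: (leqP m #|nbhd e (A 0) x|) => [_|/ltnW h].
    by rewrite mul1n (leq_trans (AM _ _ _)) ?leq_addr.
  by rewrite mul0n.
have lower := multipartite_deg_sum_all e_sym KA Udeg'.
pose miss y := #|[set x in R | ~~ e y x]|.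
have missE : \sum_(x in R) (M - #|nbhd e (A 0) x|) = \sum_(y in A 0) miss y.
  pose e' : rel V := fun x y => ~~ e x y.
  rewrite (eq_bigr (fun x => #|nbhd e' (A 0) x|)).
    by rewrite card_incidence // => x y; rewrite /e' e_sym.
  move=> x _; rewrite -A0 -(cardsID (nbhd e (A 0) x) (A 0)).
  have -> : A 0 :&: nbhd e (A 0) x = nbhd e (A 0) x.
    by apply/setIidPr/subsetP => y; rewrite inE => /andP[].
  rewrite addKn; apply: eq_card => y; rewrite !inE.
  by case: (y \in A 0); rewrite ?andbF ?andbT.
(* With its misses added, a vertex of [R] counts [A 0] in full. If it is not rich, its poor part is
   a later one, so its total is still at most t M + m; outside [R] the poor part is [A 0] itself. *)
have upper : \sum_(x in U) \sum_(i < t.+1) #|nbhd e (A i) x| +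
    \sum_(y in A 0) miss y <= u * (t * M + m) + M * L.
  rewrite -missE.
  have -> : \sum_(x in R) (M - #|nbhd e (A 0) x|) =
      \sum_(x in U) (x \in R) * (M - #|nbhd e (A 0) x|).
    rewrite big_mkcond [RHS]big_mkcond /=; apply: eq_bigr => x _.
    by rewrite inE; case: (x \in U); case: (_ <= _); rewrite ?mul1n ?mul0n.
  rewrite -big_split /=.
  apply: (@leq_trans (\sum_(x in U) (t * M + m + (x \in rich e U t.+1 m A) * M))).
    apply: leq_sum => x xU.
    have AMx i : i < t.+1 -> #|nbhd e (A i) x| <= M := @AM i x.
    have tailM : \sum_(i < t) #|nbhd e (A i.+1) x| <= t * M.
      rewrite -[X in _ <= X * _]card_ord -sum_nat_const.
      by apply: leq_sum => i _; apply: AM; rewrite ltnS.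
    have -> : \sum_(i < t.+1) #|nbhd e (A i) x| =
        #|nbhd e (A 0) x| + \sum_(i < t) #|nbhd e (A i.+1) x|.
      by rewrite big_ord_recl.
    move: (AMx 0 isT); rewrite [x \in R]inE xU /=.
    case: (leqP m #|nbhd e (A 0) x|) => [h0|h0 h]; last first.
      by move: tailM; set s := \sum_(i < t) _; lia.
    case: (boolP (x \in rich _ _ _ _ _)) => [_ h|].
      by move: tailM; set s := \sum_(i < t) _; lia.
    rewrite inE xU negb_forall => /existsP[i]; rewrite -ltnNge => im h.
    have [j jE] : exists j : 'I_t, i = lift ord0 j.
      case: (unliftP ord0 i) => [j ->|i0]; first by exists j.
      by move: im; rewrite i0 /= ltnNge h0.
    have := @sum_deficient t m M j (fun k => #|nbhd e (A k.+1) x|) (ltn_ord j)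
      (fun k kt => AMx k.+1 kt).
    rewrite jE in im; move=> /(_ (ltnW im)).
    by set s := \sum_(i < t) _; lia.
  rewrite big_split /= sum_nat_const -big_distrl /= -/u leq_add2l mulnC leq_mul2l.
  apply/orP; right; apply: leq_trans richL; rewrite -sum1_card.
  rewrite big_mkcond [X in _ <= X]big_mkcond /=; apply: leq_sum => x _.
  by case: (x \in U); case: (x \in rich _ _ _ _ _).
(* The clones are vertices of [A 0] that miss at most twice the average number of vertices of
   [R]. *)
have [|S [SA Sm Smiss]] := @markov_subset V (A 0) miss m; first by rewrite A0.
pose C := [set x in R | [forall y in S, e y x]].
exists S, C; split=> //.
  by move=> x y xS; rewrite inE => /andP[_ /forall_inP/(_ _ xS)].
(* [Z] bounds the number of vertices of [R] missed by some clone, that is, [R] minus [C]. *)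
exists #|R|, (\sum_(y in S) miss y); split.
- have : R \subset C :|: \bigcup_(y in S) [set x in R | ~~ e y x].
    apply/subsetP => x xR; rewrite inE; case: (boolP (x \in C)) => //= .
    rewrite inE xR negb_forall /= => /existsP[y]; rewrite negb_imply => /andP[yS h].
    by apply/bigcupP; exists y => //; rewrite inE xR.
  move/subset_leq_card => h; apply: leq_trans h _.
  apply: leq_trans (leq_card_setU _ _) _; rewrite leq_add2l.
  elim/big_ind2: _ => [|B b D d hB hD|//]; first by rewrite cards0.
  by apply: leq_trans (leq_card_setU _ _) _; apply: leq_add.
- have := leq_mul (leqnn (2 * (t.+1 * q))) upper0; move: lower0.
  set s := \sum_(x in U) _; set X := 2 * (t.+1 * q) * s.
  set Y := 2 * _ * (_ + _) => h1 h2.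
  have : M * (2 * a * u) <= M * (2 * a * u - a) + M * a.
    by rewrite -mulnDr leq_mul2l; lia.
  lia.
have hS : M * \sum_(y in S) miss y <= m * (2 * \sum_(z in A 0) miss z).
  rewrite big_distrr /= -Sm -sum_nat_const; apply: leq_sum => y yS.
  by rewrite -A0; apply: Smiss.
move: lower upper hS; set s := \sum_(x in U) _; set B := \sum_(z in A 0) _.
set Z := \sum_(y in S) _ => lower upper hS.
have {}lower : M * (2 * a * u) <= 2 * (q * s) + M * a.
  have h : M * (2 * a * u - a) <= 2 * q * s by nia.
  have : M * (2 * a * u) <= M * (2 * a * u - a) + M * a.
    by rewrite -mulnDr leq_mul2l; lia.
  lia.
have key : 2 * (q * B) <= 2 * q * (u * m) + 2 * q * (M * L) + 2 * M * u + M * (t * q).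
  have h1 : q * s + q * B <= q * (u * (t * M + m) + M * L) by nia.
  have h2 : q * (u * (t * M)) = a * (u * M) + u * M by nia.
  nia.
nia.
Qed.

(** As t >= 2, the ratio t / (t + 1) is at least 2 / 3. With [M] and [q] large against [m], up to
    constants R >= 63 / 100 u and Z <= u / 25, so [C] has about 59 / 100 u vertices, where u >= 99 /
    100 n. *)
Lemma clone_set (t m : nat) : 1 < t -> 0 < m ->
  exists n0, forall (V : finType) (e : rel V),
    symmetric e -> irreflexive e -> n0 <= #|V| ->
    (forall B, ~ multipartite e setT t.+2 m B) ->
    t * (#|V| * #|V|) <= t.+1 * deg_sum e setT + t.+1 * #|V| ->
    exists S C : {set V}, [/\ #|S| = m,
      (forall x y, x \in S -> y \in C -> e x y) & 11 * #|V| <= 20 * #|C|].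
Proof.
move=> t1 m0.
pose M := 100 * (m * m).
pose q := 100 * m * t.+1.
have q0 : 0 < q by rewrite /q; nia.
have t0 : 0 < t by apply: ltnW.
have [n1 core] := almost_spanning_core m0 q0 t0.
have M0 : 0 < M by rewrite /M; nia.
(* The density 1 - 1 / t + 1 / (4 t (t + 1)) is strictly below 1 - 1 / (t + 1), which leaves room
   for the loss of order 1 / q in [U]. *)
have [n2 ES] := @erdos_stone_min_degree t (4 * t.+1) M isT M0.
pose L := m * 2 ^ (t.+1 * M).
exists (n1 + 2 * n2 + 2 * (t * t) + 1000 * (m * L + m * t + 1)).
move=> V e e_sym e_irr nbig noK dense.
set n := #|V| in nbig dense *.
have [|U [Ubig Udeg]] := core V e e_sym e_irr _ noK dense; first by rewrite -/n; lia.
rewrite -/n in Ubig; set u := #|U| in Ubig Udeg.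
have [a aE] : exists a, a + 1 = t * q by exists (t * q - 1); nia.
have aE' : t * q - 1 = a by lia.
have qt : 4 * t <= q.
  by rewrite /q -mulnA; apply: leq_mul => //; rewrite (leq_trans (leqnSn t)) // leq_pmull.
have [||A KA] := ES V e U e_sym; first by rewrite -/u; lia.
  move=> v /Udeg; rewrite -/u aE'; set d := #|nbhd _ _ _| => h.
  have h1 : 2 * (t * q) * u <= 2 * (t.+1 * q) * d + t * q + 2 * u by rewrite -aE; lia.
  have h2 : t * t <= u by lia.
  have h3 : q * (t * (4 * t.+1) * d) + q * (3 * u) >= q * (4 * (t * t) * u).
    have h4 : 4 * t * u <= q * u by rewrite leq_mul2r qt orbT.
    have h5 : q * (t * t) <= q * u by rewrite leq_mul2l h2 orbT.
    have : (2 * t) * (2 * (t * q) * u) <=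
           (2 * t) * (2 * (t.+1 * q) * d + t * q + 2 * u).
      by rewrite leq_mul2l h1 orbT.
    lia.
  move: h3; rewrite -mulnDr leq_pmul2l // => h3; lia.
have richL : #|rich e U t.+1 m A| <= L.
  apply/ltnW/(rich_card e_sym m0 KA) => B KB.
  exact: noK (multipartite_sub (subsetT _) KB).
have mM : 2 * m <= M by rewrite /M mulnA leq_mul2r; apply/orP; right; lia.
have [S [C [Sm SC [R [Z [RZ hR hZ]]]]]] :=
  clone_set_core e_sym t1 m0 q0 KA richL mM Udeg.
exists S, C; split=> //.
rewrite -/u -/n aE' in hR hZ *.
have Zle : 25 * Z <= u + 50 * (m * L) + 25 * (m * t).
  have : M * q * (25 * Z) <= M * q * (u + 50 * (m * L) + 25 * (m * t)).
    have e1 : 50 * (m * q * (u * m)) * 2 = M * q * u by rewrite /M; lia.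
    have e2 : 100 * (m * (M * u)) <= M * q * u.
      have : 100 * m <= q by rewrite /q leq_pmulr.
      by move=> h; have := leq_mul (leqnn (M * u)) h; lia.
    by have := leq_mul (leqnn 25) hZ; lia.
  by rewrite leq_pmul2l // muln_gt0 M0.
have Rle : 63 * u <= 100 * R + 100.
  have e1 : u * m * 100 <= M * u.
    by have := leq_mul (leqnn (100 * u)) (leq_pmulr m m0); rewrite /M; lia.
  pose b := t.+1 * q.
  have b0 : 0 < b by rewrite muln_gt0.
  have e2 : 2 * b <= 3 * (a + 1).
    have h : 2 * t.+1 <= 3 * t by lia.
    by have := leq_mul h (leqnn q); rewrite aE /b; lia.
  have e3 : 100 <= b by rewrite /b /q -mulnA mulnCA leq_pmulr // !muln_gt0 m0.
  rewrite -/b in hR.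
  have e4 : M * b * (63 * u) <= M * b * (100 * R + 100).
    have f1 : 2 * b * (u * m) * 100 <= 2 * b * (M * u).
      by rewrite -mulnA leq_mul2l e1 orbT.
    have f2 : M * u * (2 * b) <= M * u * (3 * (a + 1)) by rewrite leq_mul2l e2 orbT.
    have f3 : M * u * 100 <= M * u * b by rewrite leq_mul2l e3 orbT.
    have f4 : M * a <= M * b by rewrite leq_mul2l /b; apply/orP; right; lia.
    lia.
  by move: e4; rewrite leq_pmul2l // muln_gt0 M0.
lia.
Qed.

(** * Greedy construction of disjoint connecting paths *)

Lemma connecting_path (V : finType) (e : rel V) (X : {set V}) (N k : nat)
    (x y : V) (Z : seq V) :
  symmetric e ->
  (forall u v, u \in X -> v \in X -> N <= #|nbhd e X u :&: nbhd e X v|) ->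
  x \in X -> y \in X -> size Z + k.+1 <= N ->
  exists p : seq V, [/\ size p = k.+1, path e x (rcons p y), uniq p &
    {in p, forall z, z \notin Z}].
Proof.
move=> e_sym common.
have pick u v (Y : seq V) : u \in X -> v \in X -> size Y < N ->
    exists w, [/\ w \in X, e u w, e w v & w \notin Y].
  move=> uX vX YN.
  case: (boolP [exists w, (w \in nbhd e X u :&: nbhd e X v) && (w \notin Y)]).
    move=> /existsP[w]; rewrite !inE => /andP[/andP[/andP[wX uw] /andP[_ vw]] wY].
    by exists w; split=> //; rewrite e_sym.
  rewrite negb_exists => /forallP h.
  have : nbhd e X u :&: nbhd e X v \subset Y.
    by apply/subsetP => w wI; have := h w; rewrite wI /= negbK.
  move/subset_leq_card => h1; have := leq_trans (common u v uX vX) h1.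
  by move/leq_trans/(_ (card_size Y)); rewrite leqNgt YN.
elim: k x Z => [|k IHk] x Z xX yX ZN.
  have [|w [wX xw wy wZ]] := pick x y Z xX yX; first by lia.
  by exists [:: w]; split=> //=; [rewrite xw wy|move=> z; rewrite inE => /eqP->].
(* Only the last inner vertex must also see [y]; before it, any new neighbour of [x] will do. *)
have [|w [wX xw _ wZ]] := pick x x Z xX xX; first by lia.
have [|p [pk pp pu pZ]] := IHk w (w :: Z) wX yX; first by rewrite /=; lia.
exists (w :: p); split=> /=; rewrite ?pk ?xw ?pu ?pp ?andbT //.
  by apply/negP => /pZ; rewrite inE eqxx.
by move=> z; rewrite inE => /predU1P[->//|/pZ]; rewrite inE negb_or => /andP[].
Qed.

(** Paths are added one by one, each avoiding [Z] and all vertices of the earlier paths. *)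
Lemma connecting_paths (V : finType) (e : rel V) (X : {set V}) (N : nat)
    (I : eqType) (s : seq I) (k : I -> nat) (x y : I -> V) (Z : seq V) :
  symmetric e ->
  (forall u v, u \in X -> v \in X -> N <= #|nbhd e X u :&: nbhd e X v|) ->
  (forall i, x i \in X) -> (forall i, y i \in X) -> (forall i, 0 < k i) ->
  uniq s -> size Z + \sum_(i <- s) k i <= N ->
  exists P : I -> seq V,
    (forall i, i \in s -> [/\ size (P i) = k i, path e (x i) (rcons (P i) (y i)),
       uniq (P i) & {in P i, forall z, z \notin Z}]) /\
    (forall i j, i \in s -> j \in s -> i != j -> {in P i, forall z, z \notin P j}).
Proof.
move=> e_sym common xX yX k0; elim: s => [|a s IHs] /=.
  by exists (fun=> [::]); split.
rewrite big_cons => /andP[a_s us] bound.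
have [|P [Pok Pdisj]] := IHs us; first by lia.
pose Y := Z ++ flatten [seq P i | i <- s].
have Ysz : size Y = size Z + \sum_(i <- s) k i.
  rewrite size_cat size_flatten /shape -map_comp sumnE big_map; congr (_ + _).
  by apply: eq_big_seq => i /Pok[].
have [|||p [pk pp pu pY]] := @connecting_path V e X N (k a).-1 (x a) (y a) Y
    e_sym common.
- exact: xX.
- exact: yX.
- by rewrite Ysz prednK //; lia.
rewrite prednK // in pk.
have pZ z : z \in p -> z \notin Z.
  by move/pY; rewrite mem_cat negb_or => /andP[].
have pP z i : z \in p -> i \in s -> z \notin P i.
  move/pY; rewrite mem_cat negb_or => /andP[_ zF] si; apply: contra zF => zP.
  by apply/flatten_mapP; exists i.
have s_a i : i \in s -> (i == a) = false.
  by move=> si; apply: contraNF a_s => /eqP <-.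
exists (fun i => if i == a then p else P i); split=> [i|i j].
  by rewrite inE; case: eqVneq => [->|_ /Pok].
rewrite !inE; case: (eqVneq i a) => [->|ia] /=; case: (eqVneq j a) => [->|ja] //=.
- by move=> _ js _ z zp; apply: pP.
- by move=> si _ _ z zP; apply/negP => zp; have := pP z i zp si; rewrite zP.
- exact: Pdisj.
Qed.

(** * Graph containment and embeddings of balloonings *)

Lemma adj_sym (T : finType) (G : sgraph T) : symmetric (adj G).
Proof. by move=> x y; rewrite /adj setUC. Qed.

Lemma adj_irr (T : finType) (G : sgraph T) : irreflexive (adj G).
Proof. by move=> x; apply/negP => /adj_neq; rewrite eqxx. Qed.

Lemma adj_rel_graph (T : finType) (r : rel T) (x y : T) :
  adj (rel_graph r) x y = (x != y) && (r x y || r y x).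
Proof.
rewrite /adj /edges /= inE; apply/idP/idP.
  case/existsP => u /existsP[v /and3P[/eqP xy uv ruv]].
  have xu : x \in [set u; v] by rewrite -xy !inE eqxx.
  have yu : y \in [set u; v] by rewrite -xy !inE eqxx orbT.
  have: x != y.
    apply: contraNneq uv => E; subst y.
    have : u \in [set x; x] by rewrite xy !inE eqxx.
    have : v \in [set x; x] by rewrite xy !inE eqxx orbT.
    by rewrite !inE !orbb => /eqP-> /eqP->.
  move: xu yu; rewrite !inE => /orP[/eqP->|/eqP->] /orP[/eqP->|/eqP->];
    by rewrite ?eqxx ?ruv ?orbT // andbT.
case/andP => xy /orP[r1|r1]; apply/existsP.
  by exists x; apply/existsP; exists y; rewrite eqxx xy.
by exists y; apply/existsP; exists x; rewrite setUC eqxx eq_sym xy.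
Qed.

Lemma containsP (S T : finType) (F : sgraph S) (G : sgraph T) :
  reflect (exists2 f : S -> T, injective f &
             forall u v, adj F u v -> adj G (f u) (f v))
          (contains F G).
Proof.
apply: (iffP existsP) => [[f /andP[/injectiveP finj /forallP fadj]]|[f finj fadj]].
  by exists f => // u v uv; have /forallP/(_ v)/implyP := fadj u; apply.
exists [ffun x => f x]; apply/andP; split.
  by apply/injectiveP => x y; rewrite !ffunE => /finj.
by apply/'forall_forallP => u v; apply/implyP => uv; rewrite !ffunE; apply: fadj.
Qed.

Lemma contains_trans (S T W : finType) (F : sgraph S) (G : sgraph T) (H : sgraph W) :
  contains F G -> contains G H -> contains F H.
Proof.
case/containsP => f finj fadj /containsP[g ginj gadj]; apply/containsP.
by exists (g \o f) => [|u v /fadj/gadj //]; apply: inj_comp.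
Qed.

Lemma ballooning_contains (T : finType) (F : sgraph T) (l : {set T} -> nat) :
  contains F (ballooning F l).
Proof.
apply/containsP; exists (fun x => inl x : balloon_vertex F l) => [x y []//|u v uv].
rewrite adj_rel_graph /= uv /= andbT; apply/eqP => -[uv'].
by move: (adj_neq uv); rewrite uv' eqxx.
Qed.

(** Disjoint paths of the right lengths that avoid [codom f] serve as the new paths. In total they
    and [codom f] have as many vertices as the ballooning, so that many common neighbours
    suffice. *)
Lemma ballooning_embeds (T V : finType) (F : sgraph T) (l : {set T} -> nat)
    (G : sgraph V) (X : {set V}) (f : T -> V) :
  (forall e : {set T}, e \in edges F -> 2 < l e) ->
  (forall u v, u \in X -> v \in X ->
     #|balloon_vertex F l| <= #|nbhd (adj G) X u :&: nbhd (adj G) X v|) ->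
  injective f -> (forall t, f t \in X) ->
  (forall u v, adj F u v -> adj G (f u) (f v)) ->
  contains (ballooning F l) G.
Proof.
move=> l_gt2 common finj fX fadj.
pose I : finType := oriented_edge F.
have inner0 (a : I) : 0 < inner l a.
  have /andP[/l_gt2] := valP a; rewrite /inner /src /tgt => h _.
  by rewrite subn_gt0.
have [|P [Pok Pdisj]] := @connecting_paths V (adj G) X _ I (enum I) (@inner T F l)
    (fun a => f (src a)) (fun a => f (tgt a)) (codom f) (@adj_sym _ G) common
    (fun a => fX _) (fun a => fX _) inner0 (enum_uniq _).
  rewrite card_sum card_tagged size_codom sumnE big_map leq_add2l.
  by under [X in _ <= X]eq_bigr do rewrite card_ord.
have {}Pok (a : I) := Pok a (mem_enum _ a).
have {}Pdisj (a b : I) : a != b -> {in P a, forall z, z \notin P b}.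
  by apply: Pdisj; rewrite mem_enum.
(* The default of [nth] is the start of the path, as [rcons_path] and [pathP] require below. *)
pose g (x : balloon_vertex F l) : V :=
  match x with
  | inl t => f t
  | inr w => nth (f (src (tag w))) (P (tag w)) (tagged w)
  end.
have gP (w : {a : I & 'I_(inner l a)}) : g (inr w) \in P (tag w).
  by rewrite /= mem_nth //; have [-> _ _ _] := Pok (tag w).
have gf w t : g (inr w) != f t.
  have [_ _ _ /(_ _ (gP w))] := Pok (tag w).
  by apply: contra => /eqP->; apply: codom_f.
have garc x y : balloon_rel x y -> adj G (g x) (g y).
  case: x y => [u|w] [v|z] /=; first exact: fadj.
  - case/andP => /eqP-> /eqP->; have [sz] := Pok (tag z).
    by case: (P _) sz (inner0 (tag z)) => [<-//|b p _ _] /= /andP[].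
  - case/andP => /eqP-> /eqP sz; have [szP + _ _] := Pok (tag w).
    have szP' : size (P (tag w)) = (tagged w).+1 by rewrite szP sz.
    by rewrite rcons_path => /andP[_]; rewrite -nth_last szP'.
  - case: w z => a i [b j] /= /andP[/eqP ab]; subst b; rewrite /= => /eqP ij.
    have [szP + _ _] := Pok a; rewrite rcons_path => /andP[+ _].
    move=> /(pathP (f (src a))) /(_ j); rewrite szP => /(_ (ltn_ord j)).
    by rewrite -ij /=.
apply/containsP; exists g => [x y|x y].
  case: x y => [u|w] [v|z]; first by move=> /finj->.
  - by move=> /eqP; rewrite eq_sym (negbTE (gf _ _)).
  - by move=> /eqP; rewrite (negbTE (gf _ _)).
  - move=> E; have := gP w; rewrite E => zw.
    have twz : tag w = tag z.
      by apply/eqP/negPn/negP => ne; have := Pdisj _ _ ne _ zw; rewrite gP.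
    case: w z twz E {zw} => a i [b j] /= ab; subst b => /= /eqP.
    have [szP _ uP _] := Pok a.
    by rewrite nth_uniq ?szP // => /eqP/val_inj->.
rewrite adj_rel_graph => /andP[_ /orP[/garc//|/garc]].
by rewrite adj_sym.
Qed.

Lemma handshake (V : finType) (G : sgraph V) :
  deg_sum (adj G) setT = 2 * #|edges G|.
Proof.
have degE x : #|nbhd (adj G) setT x| = \sum_(e in edges G) (x \in e).
  have -> : \sum_(e in edges G) (x \in e) = #|[set e in edges G | x \in e]|.
    rewrite -sum1_card big_mkcond [RHS]big_mkcond /=; apply: eq_bigr => e _.
    by rewrite inE; case: (e \in _); case: (x \in _).
  (* Sending y to {x, y} maps the neighbours of [x] bijectively onto the edges through [x]. *)
  rewrite -(card_in_imset (f := fun y => [set x; y])) => [|y z].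
    apply: eq_card => e; rewrite inE; apply/imsetP/andP.
      by case=> y; rewrite !inE /= => xy ->; rewrite !inE eqxx.
    case=> eG xe; have /forall_inP/(_ _ eG)/cards2P[y [z [yz eE]]] := valP G.
    move: xe; rewrite {1}eE !inE => /orP[]/eqP xE; subst x.
      by exists z => //; rewrite !inE /adj -eE.
    by exists y; rewrite // ?inE /adj setUC // -eE.
  rewrite !inE /= => /adj_neq xy _ /setP/(_ y); rewrite !inE eqxx orbT.
  by rewrite eq_sym (negbTE xy) => /esym/eqP.
rewrite /deg_sum; under eq_bigr do rewrite degE.
rewrite exchange_big /= mulnC -sum_nat_const; apply: eq_bigr => e eG.
have /forall_inP/(_ _ eG)/eqP <- := valP G.
by rewrite -sum1_card [RHS]big_mkcond /=; apply: eq_big => x;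
  rewrite ?inE //; case: (x \in e).
Qed.

(** * Extremal numbers and the Turan lower bound *)

Lemma ex_numP (n : nat) (S : finType) (F : sgraph S) (G : sgraph 'I_n) :
  is_free F G -> #|edges G| <= ex_num n F.
Proof. by move=> h; apply: (@leq_bigmax_cond _ (is_free F) (fun H => #|edges H|)). Qed.

Definition turan_graph (n r : nat) : sgraph 'I_n :=
  rel_graph (fun i j : 'I_n => i %% r != j %% r).

Lemma adj_turan (n r : nat) (i j : 'I_n) :
  adj (turan_graph n r) i j = (i %% r != j %% r).
Proof.
rewrite adj_rel_graph [j %% r == _]eq_sym orbb.
by case: (eqVneq i j) => [->|//]; rewrite eqxx.
Qed.

Lemma turan_free (n t : nat) (S : finType) (F : sgraph S) :
  ~~ colorable F t.+1 -> is_free F (turan_graph n t.+1).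
Proof.
apply: contra => /containsP[f finj fadj].
apply/existsP; exists [ffun x => inord (f x %% t.+1)].
apply/'forall_forallP => u v; apply/implyP => /fadj; rewrite adj_turan.
apply: contra; rewrite !ffunE => /eqP/(congr1 val) /=.
by rewrite !inordK ?ltn_pmod // => ->.
Qed.

Lemma turan_deg_sum (n t : nat) :
  t * (n * n) <= t.+1 * deg_sum (adj (turan_graph n t.+1)) setT + t.+1 * n.
Proof.
pose d := n - (n %/ t.+1).+1.
have deg x : d <= #|nbhd (adj (turan_graph n t.+1)) setT x|.
  pose B := [set y : 'I_n | y %% t.+1 == x %% t.+1].
  have -> : #|nbhd (adj (turan_graph n t.+1)) setT x| = #|~: B|.
    by apply: eq_card => y; rewrite !inE adj_turan eq_sym.
  rewrite cardsCs setCK card_ord leq_sub2l //.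
  (* Within a residue class a vertex is determined by its quotient, which takes at most n / (t + 1)
     + 1 values. *)
  pose f (y : 'I_n) : 'I_(n %/ t.+1).+1 := inord (y %/ t.+1).
  have fE (y : 'I_n) : f y = y %/ t.+1 :> nat.
    by rewrite inordK // ltnS leq_div2r // ltnW.
  have finj : {in B &, injective f}.
    move=> y z; rewrite !inE => /eqP yx /eqP zx /(congr1 val); rewrite /= !fE => yz.
    by apply: val_inj; rewrite /= (divn_eq y t.+1) (divn_eq z t.+1) yz yx zx.
  by have := leq_card_in f B finj; rewrite card_ord.
have : n * d <= deg_sum (adj (turan_graph n t.+1)) setT.
  rewrite -{1}(card_ord n) -cardsT -sum_nat_const.
  by apply: leq_sum => x _; apply: deg.
set D := deg_sum _ _ => h.
have hd : t * n <= t.+1 * d + t.+1.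
  by rewrite /d; have := leq_trunc_div n t.+1; set k := n %/ t.+1; nia.
have := leq_mul (leqnn n) hd; have := leq_mul (leqnn t.+1) h; lia.
Qed.

(** A colouring places [F] into the parts. As r >= 3, any two vertices avoid a third part, all of
    which is common to their neighbourhoods, so the new paths fit as well. *)
Lemma multipartite_contains (T V : finType) (F : sgraph T) (G : sgraph V)
    (l : {set T} -> nat) (r M : nat) (A : nat -> {set V}) :
  (forall e : {set T}, e \in edges F -> 2 < l e) -> 2 < r -> colorable F r ->
  #|balloon_vertex F l| < M -> multipartite (adj G) setT r M A ->
  contains (ballooning F l) G.
Proof.
move=> l2 r2 /existsP[c /'forall_forallP cP] mM [Asz Aadj].
have TM : #|T| <= M by apply: leq_trans (ltnW mM); rewrite card_sum leq_addr.
have Acard i : i < r -> #|A i| = M by move=> ir; have [] := Asz i ir.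
have [x0 _] : exists x0, x0 \in A 0.
  by apply/set0Pn; rewrite -card_gt0 Acard ?(leq_ltn_trans _ mM) // (leq_ltn_trans _ r2).
pose X := [set x | [exists i : 'I_r, x \in A i]].
have enum_lt t : enum_rank t < size (enum (A (c t))).
  by rewrite -cardE Acard // (leq_trans _ TM).
pose f t := nth x0 (enum (A (c t))) (enum_rank t).
have fA t : f t \in A (c t) by rewrite -mem_enum mem_nth.
apply: (@ballooning_embeds _ _ _ _ _ X f) => //.
- move=> u v; rewrite !inE => /existsP[i ui] /existsP[j vj].
  have [k [kr ki kj]] : exists k, [/\ k < r, k != i :> nat & k != j :> nat].
    case: (nat_of_ord i) (nat_of_ord j) => [|[|i']] [|[|j']];
      [exists 1|exists 2|exists 1|exists 2|exists 0|exists 0|exists 1|exists 0|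
       exists 0];
      by split=> //; lia.
  apply: leq_trans (ltnW mM) _; rewrite -(Acard k kr).
  apply/subset_leq_card/subsetP => z zk.
  rewrite !inE (Aadj i k) 1?eq_sym // (Aadj j k) 1?eq_sym // !andbT andbb.
  by apply/existsP; exists (Ordinal kr).
- move=> u v; have [cuv|cuv] := eqVneq (c u) (c v).
    rewrite /f -cuv => /eqP; rewrite nth_uniq ?enum_uniq //; last by rewrite cuv.
    by move/eqP/val_inj/enum_rank_inj.
  move=> fuv; have := Aadj (c u) (c v) _ _ (ltn_ord _) (ltn_ord _) cuv (fA u) (fA v).
  by rewrite fuv adj_irr.
- by move=> t; rewrite inE; apply/existsP; exists (c t).
- move=> u v uv; apply: (Aadj (c u) (c v)) => //; exact: implyP (cP u v) uv.
Qed.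

(** * Cloning and the structure of extremal graphs *)

(** The new neighbourhood of [v] is recorded in one direction only, since [rel_graph]
    symmetrises. *)
Definition clone_rel (V : finType) (e : rel V) (v : V) (C : {set V}) : rel V :=
  fun x y => if x == v then y \in C :\ v else if y == v then false else e x y.

(** A copy of [F] in the modified graph that uses [v] can use an unoccupied vertex of [A] instead,
    which is joined in [G] to all of [C]. So the modified graph is [F]-free and has no more edges
    than [G]; the two differ only at [v]. *)
Lemma clone_min_degree (n : nat) (S : finType) (F : sgraph S) (G : sgraph 'I_n)
    (A C : {set 'I_n}) (v : 'I_n) :
  G \in EX n F -> #|S| < #|A| ->
  (forall x y, x \in A -> y \in C -> adj G x y) ->
  #|C| <= #|nbhd (adj G) setT v| + 1.
Proof.
rewrite inE => /andP[Gfree /eqP Gmax] SA AC.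
pose H := rel_graph (clone_rel (adj G) v C).
have adjH x y : adj H x y = if x == v then y \in C :\ v else
    if y == v then x \in C :\ v else adj G x y.
  rewrite adj_rel_graph /clone_rel !inE.
  case: (eqVneq x v) => [->|xv]; case: (eqVneq y v) => [->|yv] //=.
  - by rewrite orbF.
  - by rewrite xv.
  - by rewrite [adj G y x]adj_sym orbb; case: eqVneq => [->|//]; rewrite adj_irr.
have Hfree : is_free F H.
  apply: contra Gfree => /containsP[g ginj gadj]; apply/containsP.
  have [w gw|nov] := pickP (fun w => g w == v); last first.
    exists g => // x y /gadj; rewrite adjH.
    by have := nov x; have := nov y; rewrite /= => -> ->.
  have [s sA sg] : exists2 s, s \in A & s \notin codom g.
    case: (boolP [exists s, (s \in A) && (s \notin codom g)]).
      by case/existsP => s /andP[]; exists s.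
    rewrite negb_exists => /forallP h.
    have /subset_leq_card : A \subset codom g.
      by apply/subsetP => s sA; have := h s; rewrite sA /= negbK.
    by rewrite (card_codom ginj) leqNgt SA.
  move/eqP: gw => gw.
  have gv x : x != w -> (g x == v) = false.
    by move=> xw; apply: contraNF xw => /eqP; rewrite -gw => /ginj->.
  exists (fun x => if x == w then s else g x) => [x y|x y].
    case: (eqVneq x w) => [->|xw]; case: (eqVneq y w) => [->|yw] // E.
    - by case/negP: sg; rewrite E; apply: codom_f.
    - by case/negP: sg; rewrite -E; apply: codom_f.
    - exact: ginj.
  move=> xy; have := gadj _ _ xy; rewrite adjH.
  case: (eqVneq x w) => [->|xw]; case: (eqVneq y w) => [->|yw].
  - by rewrite gw eqxx !inE eqxx.
  - by rewrite gw eqxx inE => /andP[_]; apply: AC.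
  - by rewrite gv // gw eqxx inE adj_sym => /andP[_]; apply: AC.
  - by rewrite !gv.
have := ex_numP Hfree; rewrite -Gmax => HG.
have : deg_sum (adj H) setT <= deg_sum (adj G) setT by rewrite !handshake leq_mul2l.
rewrite !(deg_sumD1 (@adj_sym _ _) (@adj_irr _ _) (in_setT v)).
have -> : deg_sum (adj H) (setT :\ v) = deg_sum (adj G) (setT :\ v).
  apply: eq_bigr => x; rewrite !inE andbT => xv; apply: eq_card => y.
  by rewrite !inE andbT adjH (negbTE xv); case: (y == v).
rewrite leq_add2l leq_mul2l /=.
have -> : #|nbhd (adj H) setT v| = #|C :\ v|.
  by apply: eq_card => y; rewrite !inE adjH eqxx !inE.
by rewrite (cardsD1 v C) addnC => h; apply: leq_add h (leq_b1 _).
Qed.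

Lemma extremal_ballooning_free (T : finType) (F : sgraph T) (l : {set T} -> nat)
    (t : nat) :
  (forall e : {set T}, e \in edges F -> 2 < l e) ->
  1 < t -> colorable F t.+2 -> ~~ colorable F t.+1 ->
  exists n0, forall n, n0 <= n ->
    forall G, G \in EX n (ballooning F l) -> is_free F G.
Proof.
move=> l2 t1 colF ncolF; pose m := #|balloon_vertex F l|.
have [n0 clone] := @clone_set t m.+1 t1 isT.
exists (n0 + 10 * m + 100) => n nbig G GEX.
have [/= Gfree /eqP Gmax] : is_free (ballooning F l) G /\
    #|edges G| == ex_num n (ballooning F l) by apply/andP; rewrite inE in GEX.
have noK B : ~ multipartite (adj G) setT t.+2 m.+1 B.
  move=> KB; case/negP: Gfree.
  exact: (multipartite_contains l2 (ltnW t1 : 2 < t.+2) colF (ltnSn m) KB).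
(* The Turan graph is free of [F], hence of its ballooning, so [G] has at least as many edges. *)
have dense : t * (#|'I_n| * #|'I_n|) <=
    t.+1 * deg_sum (adj G) setT + t.+1 * #|'I_n|.
  rewrite card_ord; apply: leq_trans (turan_deg_sum n t) _.
  rewrite leq_add2r leq_mul2l /=.
  rewrite !handshake leq_mul2l Gmax ex_numP //.
  by apply: contra (turan_free n ncolF) => /(contains_trans (ballooning_contains F l)).
have [|A [C [Am AC Cbig]]] := clone _ _ (@adj_sym _ G) (@adj_irr _ G) _ noK dense.
  by rewrite card_ord; lia.
rewrite card_ord in Cbig.
have deg v : #|C| <= #|nbhd (adj G) setT v| + 1.
  by apply: (clone_min_degree _ GEX _ AC); rewrite Am.
apply: contra Gfree => /containsP[f finj fadj].
apply: (@ballooning_embeds _ _ _ _ _ setT f) => // u v _ _; rewrite -/m.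
(* Two neighbourhoods of size at least 11 n / 20 - 1 meet in at least n / 10 - 2 vertices. *)
have := cardsUI (nbhd (adj G) setT u) (nbhd (adj G) setT v).
have := max_card (nbhd (adj G) setT u :|: nbhd (adj G) setT v).
rewrite card_ord; have := deg u; have := deg v; lia.
Qed.

Theorem theorem1p2 (T : finType) (F : sgraph T) (l : {set T} -> nat)
  (chi_ge4 : 4 <= chromatic_number F)
  (l_odd : forall e : {set T}, e \in edges F -> odd (l e))
  (l_ge5 : forall e : {set T}, e \in edges F -> 5 <= l e) :
  exists n0 : nat, forall n : nat, n0 <= n ->
    EX n (ballooning F l) = EX n F.
Proof.
have l_gt2 (e : {set T}) : e \in edges F -> 2 < l e by move/l_ge5/ltnW/ltnW.
have [t [t1 colF ncolF]] : exists t, [/\ 1 < t, colorable F t.+2 &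
    ~~ colorable F t.+1].
  move: chi_ge4; rewrite /chromatic_number; case: ex_minnP => k colk kmin k4.
  case: k colk kmin k4 => [|[|t]] // colk kmin k4; exists t; split=> //.
  by apply/negP => /kmin; rewrite ltnn.
have [n0 Hn0] := extremal_ballooning_free l_gt2 t1 colF ncolF.
have free_balloon n (G : sgraph 'I_n) : is_free F G -> is_free (ballooning F l) G.
  by apply: contra; apply: contains_trans; apply: ballooning_contains.
exists n0 => n /Hn0 freeF.
have exE : ex_num n (ballooning F l) = ex_num n F.
  apply/eqP; rewrite eqn_leq; apply/andP; split; last first.
    by apply/bigmax_leqP => G /free_balloon; apply: ex_numP.
  (* If no graph avoids the ballooning, the maximum over the empty family is 0. *)
  have [G0 G0free|none] := pickP (is_free (ballooning F l) : pred (sgraph 'I_n)).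
    rewrite {1}/ex_num (bigmax_eq_arg G0) //; case: arg_maxnP => // G Gfree Gmax.
    apply/ex_numP/freeF; rewrite inE Gfree eqn_leq ex_numP //.
    by apply/bigmax_leqP => H /Gmax.
  by rewrite /ex_num big_pred0.
apply/setP => G; rewrite !inE exE; apply/andP/andP => -[Gfree Gmax]; split=> //.
  by apply: freeF; rewrite inE Gfree exE.
exact: free_balloon.
Qed.
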